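(* Let $r\geq 2$ and $n>r^{8}$. Every graph $G$ of order $n$ with $e(G)\geq t_r(n)$ that is not isomorphic to $T_r(n)$ satisfies $$js^{(2,r+1,2)}(G)>\frac{n^{r-1}}{r^{r+5}}.$$
   Context: All graphs are finite and simple; $e(G)$ is the number of edges. $T_r(n)$ denotes the Turán graph: the complete $r$-partite graph on $n$ vertices whose $r$ parts have sizes as equal as possible; $t_r(n)=e(T_r(n))$. For an integer $r\geq 2$, $js^{(2,r+1,2)}(G)$ is the maximum, over all edges $uv$ of $G$, of the number of $(r+1)$-cliques of $G$ containing both $u$ and $v$ (and $0$ if $G$ has no edges). *)

(* Defs.v *)
From mathcomp Require Import all_boot.
Set Implicit Arguments. Unset Strict Implicit. Unset Printing Implicit Defensive.

Definition simple_graph (n : nat) (e : rel 'I_n) : Prop :=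
  irreflexive e /\ symmetric e.

Definition num_edges (n : nat) (e : rel 'I_n) : nat :=
  #|[set p : 'I_n * 'I_n | (p.1 < p.2)%N && e p.1 p.2]|.

(* Turán graph T_r(n) on 'I_n: vertex i is in part (i mod r); the parts
   then have sizes floor(n/r) or ceil(n/r), i.e. as equal as possible.
   Two vertices are adjacent iff they lie in different parts. *)
Definition turan_rel (r n : nat) : rel 'I_n :=
  fun x y => (x %% r) != (y %% r).

Definition turan_number (r n : nat) : nat := num_edges (@turan_rel r n).

Definition graph_iso (n : nat) (e h : rel 'I_n) : Prop :=
  exists f : 'I_n -> 'I_n, bijective f /\ forall x y, e x y = h (f x) (f y).

Definition is_clique (n : nat) (e : rel 'I_n) (S : {set 'I_n}) : bool :=
  [forall x in S, forall y in S, (x != y) ==> e x y].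

Definition cliques_through (n : nat) (e : rel 'I_n) (k : nat) (u v : 'I_n) : nat :=
  #|[set S : {set 'I_n} | [&& #|S| == k, u \in S, v \in S & is_clique e S]]|.

(* js^{(2,r+1,2)}(G): maximum over edges uv of the number of (r+1)-cliques
   containing u and v; 0 if there are no edges. *)
Definition js2 (n : nat) (e : rel 'I_n) (r : nat) : nat :=
  \max_(p : 'I_n * 'I_n | e p.1 p.2) cliques_through e r.+1 p.1 p.2.

(* Main.v *)
Require Import Defs.
From mathcomp Require Import all_boot fingroup perm zify.
Set Implicit Arguments. Unset Strict Implicit. Unset Printing Implicit Defensive.

(** Delete, one at a time, vertices whose degree in the current w-vertex induced
    subgraph is below (1 - 1/r - 1/r^4) w.  If this gets stuck within n/r
    deletions, either the remaining graph has a K_{r+1}, and the minimum degree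
    condition forces an edge of that clique to lie in many (r+1)-cliques
    (averaging the common neighbourhoods of the pairs, then extending greedily);
    or it is K_{r+1}-free and the uniqueness part of Turan's theorem applies,
    which leaves only T_r(n) since each deletion strictly increases the
    excess e - t_r.  If the deletion does not get stuck, the excess has become
    quadratic in n, and the Moon-Moser inequalities produce so many
    (r+1)-cliques that an average edge already lies in enough of them. *)

(** * Cliques and common neighbourhoods within a vertex set *)

Section CliqueCounting.
Variables (T : finType) (e : rel T).
Hypotheses (e_irr : irreflexive e) (e_sym : symmetric e).
Implicit Types (W K L S : {set T}) (x y v : T).

Definition clique S := [forall x in S, forall y in S, (x != y) ==> e x y].

(** The lower end [K] covers both all k-cliques of [W], with [K] empty, and those through an edge,
    with [K] the pair of its ends. *)
Definition cliques W K k :=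
  [set S : {set T} | [&& K \subset S, S \subset W, #|S| == k & clique S]].

Definition nbhd W K := [set x in W | [forall y in K, e x y]].

Definition deg W x := #|nbhd W [set x]|.

Definition degsum W := \sum_(x in W) deg W x.

Lemma cliqueP S :
  reflect {in S &, forall x y, x != y -> e x y} (clique S).
Proof.
apply: (iffP forall_inP) => [H x y xS yS xy|H x xS].
  by move/(_ x xS)/forall_inP/(_ y yS)/implyP: H; apply.
by apply/forall_inP => y yS; apply/implyP; apply: H.
Qed.

Lemma cliquesP W K k S :
  reflect [/\ K \subset S, S \subset W, #|S| = k & clique S] (S \in cliques W K k).
Proof.
by rewrite inE; apply: (iffP and4P) => [[? ? /eqP ? ?]|[? ? /eqP ? ?]]; split.
Qed.

Lemma nbhdP W K x :
  reflect (x \in W /\ {in K, forall y, e x y}) (x \in nbhd W K).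
Proof. by rewrite inE; apply: (iffP andP) => -[? /forall_inP]; split. Qed.

Lemma nbhd_notin W K x : x \in nbhd W K -> x \notin K.
Proof. by case/nbhdP => _ H; apply/negP => /H; rewrite e_irr. Qed.

Lemma nbhd_sub W K : nbhd W K \subset W.
Proof. by apply/subsetP => x /nbhdP[]. Qed.

Lemma nbhd1E W x y : (y \in nbhd W [set x]) = (y \in W) && e x y.
Proof.
rewrite !inE; congr andb; apply/forall_inP/idP => [/(_ x)|exy z].
  by rewrite inE eqxx e_sym; apply.
by rewrite inE => /eqP->; rewrite e_sym.
Qed.

Lemma nbhd0 W : nbhd W set0 = W.
Proof.
apply/setP => x; rewrite !inE; case: (x \in W) => //=.
by apply/forall_inP => y; rewrite inE.
Qed.

Lemma nbhdU1 W K x : nbhd W (x |: K) = nbhd W K :&: nbhd W [set x].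
Proof.
apply/setP => z; rewrite in_setI nbhd1E; apply/nbhdP/andP.
  move=> [zW H]; split; first by apply/nbhdP; split=> // y yK; rewrite H ?setU1r.
  by rewrite zW e_sym H ?setU11.
move=> [/nbhdP[zW H] /andP[_ exz]]; split=> // y /setU1P[->|/H //].
by rewrite e_sym.
Qed.

Lemma cliqueS S S' : S' \subset S -> clique S -> clique S'.
Proof.
move=> /subsetP sub /cliqueP cS; apply/cliqueP => x y xS yS.
by apply: cS; apply: sub.
Qed.

Lemma clique_nbhd W S x :
  S \subset W -> clique S -> x \in S -> x \in nbhd W (S :\ x).
Proof.
move=> /subsetP sub /cliqueP cS xS; apply/nbhdP; split; first exact: sub.
by move=> y /setD1P[yx yS]; rewrite cS // eq_sym.
Qed.

Lemma cliqueU1 W K x : clique K -> x \in nbhd W K -> clique (x |: K).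
Proof.
move=> /cliqueP cK /nbhdP[_ xK]; apply/cliqueP => y z.
case/setU1P=> [->|yK] /setU1P[->|zK]; rewrite ?eqxx // => ne.
- exact: xK.
- by rewrite e_sym xK.
exact: cK.
Qed.

Lemma clique0 : clique set0.
Proof. by apply/cliqueP => x y; rewrite inE. Qed.

Lemma clique1 x : clique [set x].
Proof. by apply/cliqueP => y z /set1P-> /set1P->; rewrite eqxx. Qed.

(** * Double counting and greedy extension of cliques *)

(** Double count the pairs (S, x) with x in S outside [K]: any such x is a common neighbour of
    [K]. *)
Lemma extension_count W K k :
  (k - #|K|) * #|cliques W K k| = \sum_(x in nbhd W K) #|cliques W (x |: K) k|.
Proof.
transitivity (\sum_(S in cliques W K k) \sum_(x in nbhd W K | x \in S) 1).
  rewrite mulnC -sum_nat_const; apply: eq_bigr => S /cliquesP[KS SW <- cS].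
  rewrite -(cardsDS KS) -sum1_card; apply: eq_bigl => x; rewrite inE andbC.
  case xS: (x \in S); rewrite ?andbF // !andbT.
  apply/idP/idP => [xK|]; last exact: nbhd_notin.
  apply/nbhdP; split=> [|y yK]; first exact: (subsetP SW).
  apply: (cliqueP _ cS) => //; first exact: (subsetP KS).
  by apply: contraNneq xK => ->.
rewrite (exchange_big_dep (mem (nbhd W K))) /=; last by move=> ? ? _ /andP[].
apply: eq_bigr => x xN; rewrite sum1_card; apply: eq_card => S.
rewrite [LHS]unfold_in /= xN [in RHS]inE subUset sub1set inE.
by case: (x \in S); rewrite ?andbF ?andbT.
Qed.

Lemma cliques_self W K : K \subset W -> clique K -> cliques W K #|K| = [set K].
Proof.
move=> KW cK; apply/setP => S; apply/cliquesP/set1P.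
  by case=> KS _ cS _; apply/esym/eqP; rewrite eqEcard KS cS leqnn.
by move=> ->.
Qed.

Lemma degsum_edges W : degsum W = 2 * #|cliques W set0 2|.
Proof.
have := extension_count W set0 2; rewrite cards0 subn0 nbhd0 => ->.
apply: eq_bigr => x xW; have := extension_count W [set x] 2.
rewrite cards1 mul1n setU0 => ->; rewrite /deg -sum1_card.
apply: eq_bigr => y yN; have ynx := nbhd_notin yN.
have -> : 2 = #|y |: [set x]| by rewrite cardsU1 ynx cards1.
rewrite cliques_self ?cards1 //; last exact: cliqueU1 (clique1 x) yN.
by apply/subsetP => z /setU1P[->|/set1P-> //]; case/nbhdP: yN.
Qed.

Lemma card_nbhdU1 W K m x : x \in W ->
  (forall v, v \in W -> #|W| <= deg W v + m) ->
  #|nbhd W K| - m <= #|nbhd W (x |: K)|.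
Proof.
move=> xW /(_ x xW) Hm; rewrite nbhdU1.
have := cardsUI (nbhd W K) (nbhd W [set x]); rewrite -/(deg W x).
have : #|nbhd W K :|: nbhd W [set x]| <= #|W|.
  by apply: subset_leq_card; rewrite subUset !nbhd_sub.
by lia.
Qed.

(** Add vertices one at a time: each new vertex misses at most [m] vertices of [W], so choice i,
    counted from 0, has at least a - i m options, and each clique arises in at most j! orders. *)
Lemma greedy W m : (forall v, v \in W -> #|W| <= deg W v + m) ->
  forall j K a, K \subset W -> clique K -> a <= #|nbhd W K| ->
  \prod_(i < j) (a - i * m) <= j`! * #|cliques W K (#|K| + j)|.
Proof.
move=> Hm; elim=> [|j IHj] K a KW cK aK.
  by rewrite big_ord0 addn0 cliques_self ?cards1.
rewrite factS [j.+1 * _]mulnC -mulnA.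
have := extension_count W K (#|K| + j.+1); rewrite addKn => ->.
rewrite big_distrr /= big_ord_recl mul0n subn0.
apply: leq_trans (_ : #|nbhd W K| * \prod_(i < j) (a - m - i * m) <= _).
  by rewrite leq_mul // leq_prod // => i _; rewrite lift0 mulSn subnDA.
rewrite -sum_nat_const; apply: leq_sum => x xN.
have -> : #|K| + j.+1 = #|x |: K| + j by rewrite cardsU1 (nbhd_notin xN) add1n addnS addSn.
have xW : x \in W by case/nbhdP: xN.
apply: IHj; first by rewrite subUset sub1set xW.
  exact: cliqueU1 cK xN.
by apply: leq_trans (card_nbhdU1 K xW Hm); rewrite leq_sub2r.
Qed.

(** * Moon-Moser inequalities *)

(** Removing v from K matches the pairs (K, v) with the pairs (L, x) where x is a common neighbour
    of L. *)
Lemma clique_pred_reindex W s (F : {set T} -> nat) :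
  \sum_(K in cliques W set0 s.+1) \sum_(v in K) F (K :\ v) =
  \sum_(L in cliques W set0 s) #|nbhd W L| * F L.
Proof.
transitivity (\sum_(L in cliques W set0 s) \sum_(x in nbhd W L) F L); last first.
  by apply: eq_bigr => L _; rewrite sum_nat_const.
rewrite !pair_big_dep /=.
rewrite (reindex_onto (fun p => (p.2 |: p.1, p.2)) (fun p => (p.1 :\ p.2, p.2))).
  apply: eq_big => [[L x]|[L x]] /=.
    rewrite setU11 andbT xpair_eqE eqxx andbT; apply/andP/andP.
      move=> [/cliquesP[_ SW cS clS] /eqP eqL]; rewrite -eqL.
      split; last by rewrite clique_nbhd ?setU11.
      apply/cliquesP; split; rewrite ?sub0set //.
      - by apply: subset_trans SW; rewrite subD1set.
      - by move: cS; rewrite (cardsD1 x) setU11; lia.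
      by apply: cliqueS clS; rewrite subD1set.
    move=> [/cliquesP[_ LW cL clL] xN]; have xL := nbhd_notin xN.
    rewrite setU1K ?eqxx //; split=> //; apply/cliquesP; split.
    - by rewrite sub0set.
    - by rewrite subUset sub1set LW andbT; case/nbhdP: xN.
    - by rewrite cardsU1 xL cL.
    exact: cliqueU1 clL xN.
  by case/andP=> _ /eqP[->].
by case=> K v /= /andP[_ vK]; rewrite setD1K.
Qed.

(* A vertex x of W outside [nbhd W K] misses some w in K, so it is counted only
   for v = w: it contributes at most 1 to the sum. *)
Lemma sum_nbhd_drop W K : K \subset W -> clique K -> 0 < #|K| ->
  \sum_(v in K) #|nbhd W (K :\ v)| <= #|W| + (#|K| - 1) * #|nbhd W K|.
Proof.
move=> KW cK K0.
have -> : \sum_(v in K) #|nbhd W (K :\ v)| =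
   \sum_(x in W) \sum_(v in K | x \in nbhd W (K :\ v)) 1.
  under eq_bigr do rewrite -sum1_card.
  rewrite (exchange_big_dep (mem W)) //=.
  by move=> v x _; apply: (subsetP (nbhd_sub _ _)).
rewrite (bigID (mem (nbhd W K))) /= addnC.
have -> : #|W| + (#|K| - 1) * #|nbhd W K| = #|W :\: nbhd W K| + #|nbhd W K| * #|K|.
  have := cardsID (nbhd W K) W; rewrite (setIidPr (nbhd_sub W K)).
  by move: K0; case: #|K| => // k _; rewrite subn1 /=; lia.
apply: leq_add.
  have -> : #|W :\: nbhd W K| = \sum_(x in W | x \notin nbhd W K) 1.
    by rewrite -sum1_card; apply: eq_bigl => x; rewrite !inE andbC.
  apply: leq_sum => x /andP[xW xK]; rewrite sum1_card leqNgt.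
  apply/negP => /card_gt1P[v [w [/andP[vK vN] /andP[wK wN] vw]]].
  case/negP: xK; apply/nbhdP; split=> // y yK.
  have [yv|yv] := eqVneq y v.
    by case/nbhdP: wN => _; apply; rewrite yv !inE vw.
  by case/nbhdP: vN => _; apply; rewrite !inE yv.
rewrite -sum_nat_const.
rewrite (eq_bigl (mem (nbhd W K))); last first.
  by move=> x /=; apply: andb_idl; apply: (subsetP (nbhd_sub _ _)).
apply: leq_sum => x _; rewrite sum1_card.
by apply: subset_leq_card; apply/subsetP => v /andP[].
Qed.

Lemma sum_sqr_ge (I : finType) (A : {set I}) (d : I -> nat) :
  (\sum_(i in A) d i) ^ 2 <= #|A| * \sum_(i in A) d i ^ 2.
Proof.
rewrite -(leq_pmul2l (_ : 0 < 2)) // -mulnn big_distrlr /=.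
have -> : 2 * (#|A| * \sum_(i in A) d i ^ 2) =
  \sum_(i in A) \sum_(j in A) (d i ^ 2 + d j ^ 2).
  under [RHS]eq_bigr do rewrite big_split /= sum_nat_const.
  by rewrite big_split /= -big_distrr /= sum_nat_const; lia.
rewrite big_distrr /=; apply: leq_sum => i _.
rewrite big_distrr /=; apply: leq_sum => j _.
exact: (nat_Cauchy (d i) (d j)).1.
Qed.

(** Cauchy-Schwarz for the common neighbourhood sizes of the s-cliques. Their sum is (s+1) k_{s+1};
    the sum of their squares is reindexed over (s+1)-cliques and bounded by [sum_nbhd_drop]. *)
Lemma moon_moser W s :
  s.+1 ^ 2 * #|cliques W set0 s.+1| ^ 2 <=
  #|cliques W set0 s| * (#|W| * #|cliques W set0 s.+1| +
     s * s.+2 * #|cliques W set0 s.+2|).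
Proof.
have sumN j : \sum_(L in cliques W set0 j) #|nbhd W L| =
    j.+1 * #|cliques W set0 j.+1|.
  under eq_bigr do rewrite -[#|nbhd _ _|]muln1.
  rewrite -(clique_pred_reindex W j (fun=> 1)) mulnC -sum_nat_const.
  by apply: eq_bigr => K /cliquesP[_ _ <- _]; rewrite sum1_card.
rewrite -expnMn -sumN; apply: leq_trans (sum_sqr_ge _ _) _.
rewrite leq_mul2l; apply/orP; right.
under eq_bigr do rewrite -mulnn.
rewrite -(clique_pred_reindex W s (fun L => #|nbhd W L|)).
apply: leq_trans (_ : \sum_(K in cliques W set0 s.+1) (#|W| + s * #|nbhd W K|) <= _).
  apply: leq_sum => K /cliquesP[_ KW cK clK].
  by have := sum_nbhd_drop KW clK; rewrite cK subn1; apply.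
by rewrite big_split /= sum_nat_const -big_distrr /= sumN mulnA [_ * #|W|]mulnC.
Qed.

Lemma degsum_le W : degsum W <= #|W| ^ 2.
Proof.
rewrite -mulnn -[X in _ <= X]sum_nat_const; apply: leq_sum => x _.
exact: subset_leq_card (nbhd_sub _ _).
Qed.

(* With E = [degsum W] = 2e and w = #|W|, this says that the ratio
   (s+2) k_{s+2} / k_{s+1} is at least w (1 - (s+1) (1 - E / w^2)). *)
Lemma clique_growth W s : 
  #|W| ^ 2 * #|cliques W set0 s.+1| <=
  #|W| * s.+2 * #|cliques W set0 s.+2| +
    s.+1 * (#|W| ^ 2 - degsum W) * #|cliques W set0 s.+1|.
Proof.
have dle := degsum_le W.
have c0 : #|cliques W set0 0| = 1.
  by have := cliques_self (sub0set W) clique0; rewrite cards0 => ->; rewrite cards1.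
have c1 : #|cliques W set0 1| = #|W|.
  have := extension_count W set0 1; rewrite cards0 mul1n nbhd0 => ->.
  rewrite -sum1_card; apply: eq_bigr => x xW; rewrite setU0.
  by have := @cliques_self W [set x]; rewrite sub1set cards1 => -> //; rewrite ?cards1 ?clique1.
elim: s => [|s IHs].
  by rewrite c1; have := degsum_edges W; nia.
have := moon_moser W s.+1.
move: IHs; set k1 := #|cliques _ _ s.+1|; set k2 := #|cliques _ _ s.+2|.
set k3 := #|cliques _ _ s.+3|; set t := _ - degsum W; set w := #|W|.
(* If k1 = 0, Moon-Moser forces k2 = 0. Otherwise the goal, multiplied by (s+1) k1, is the sum of
   (s+2) k2 times the induction hypothesis and w times Moon-Moser. *)
have [->|k10] := posnP k1.
  rewrite !mul0n leqn0 muln_eq0 /= expn_eq0 => _ /andP[/eqP-> _].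
  by rewrite !muln0.
move=> IH MM.
have IH' := leq_mul (leqnn (s.+2 * k2)) IH.
have MM' := leq_mul (leqnn w) MM.
rewrite -(leq_pmul2l (_ : 0 < s.+1 * k1)) ?muln_gt0 //.
move: IH' MM'; rewrite -!mulnn; clear; nia.
Qed.

(** * Edges lying in many cliques *)

Lemma nbhd2E W u v x : (x \in nbhd W [set u; v]) = [&& x \in W, e x u & e x v].
Proof.
by rewrite nbhdU1 in_setI !nbhd1E (e_sym u) (e_sym v); case: (x \in W) => //=; rewrite andbC.
Qed.

(** Average over the ordered pairs of [K]. If x has D neighbours in [K], the codegrees add up to the
    sum of D (D-1) over x, and D (D-1) >= 2 (r-1) D - r (r-1) reduces this to the degree sum over
    [K]. *)
Lemma clique_edge_codegree W K m r :
  (forall v, v \in W -> #|W| <= deg W v + m) ->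
  K \subset W -> #|K| = r.+1 -> 0 < r ->
  exists u v, [/\ u \in K, v \in K, u != v &
    2 * (r - 1) * r.+1 * #|W| <=
      r.+1 * r * #|nbhd W [set u; v]| + r * (r - 1) * #|W|
      + 2 * (r - 1) * r.+1 * m].
Proof.
move=> Hm KW cK r0.
set B := 2 * _ * _ * _; set B' := 2 * _ * _ * m.
case: (pickP (fun p : T * T => [&& p.1 \in K, p.2 \in K, p.1 != p.2 &
  B <= r.+1 * r * #|nbhd W [set p.1; p.2]| + r * (r - 1) * #|W| + B'])) => /=.
  by move=> [u v] /and4P[]; exists u, v.
move=> noP; exfalso.
pose D x := \sum_(u in K) e x u.
have sumdeg : \sum_(u in K) deg W u = \sum_(x in W) D x.
  rewrite exchange_big /=; apply: eq_bigr => u _.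
  rewrite /deg -sum1_card [LHS]big_mkcond [RHS]big_mkcond /=.
  apply: eq_bigr => x _; rewrite nbhd1E e_sym.
  by case: (x \in W) => //=; case: (e x u).
have sumcodeg : \sum_(u in K) \sum_(v in K | v != u) #|nbhd W [set u; v]| =
    \sum_(x in W) D x * (D x - 1).
  transitivity (\sum_(x in W) \sum_(u in K) \sum_(v in K | v != u) e x u * e x v).
    rewrite exchange_big /=; apply: eq_bigr => u _.
    rewrite exchange_big /=; apply: eq_bigr => v _.
    rewrite -sum1_card [LHS]big_mkcond [RHS]big_mkcond /=.
    apply: eq_bigr => x _; rewrite nbhd2E.
    by case: (x \in W) => //=; case: (e x u); case: (e x v).
  apply: eq_bigr => x _; rewrite big_distrl /=; apply: eq_bigr => u uK.
  rewrite -big_distrr /= /D [in RHS](bigD1 u) //=.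
  by case: (e x u); rewrite ?mul0n // addKn.
have lo : 2 * (r - 1) * (r.+1 * #|W|) <=
    \sum_(x in W) D x * (D x - 1) + r * (r - 1) * #|W| + B'.
  apply: leq_trans (_ : 2 * (r - 1) * (\sum_(u in K) deg W u + r.+1 * m) <= _).
    rewrite leq_mul2l -cK -!sum_nat_const -big_split /=; apply/orP; right.
    by apply: leq_sum => u uK; apply: Hm; apply: (subsetP KW).
  rewrite mulnDr sumdeg [X in _ + X <= _]mulnA leq_add2r.
  rewrite [r * _ * _]mulnC -sum_nat_const -big_split big_distrr /=.
  apply: leq_sum => x _; move: (D x) => d.
  (* (d - r) (d - r + 1) >= 0 *)
  by have [/subnKC <-|/subnKC <-] := leqP r d; case: (r) r0 => // q _;
    rewrite ?subn1 /=; nia.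
have hi : r.+1 * r * \sum_(x in W) D x * (D x - 1) + r.+1 * r * (r * (r - 1) * #|W| + B')
   < r.+1 * r * B.
  have cnt c : \sum_(u in K) \sum_(v in K | v != u) c = r.+1 * r * c.
    rewrite -mulnA -{1}cK -sum_nat_const; apply: eq_bigr => u uK.
    have -> : r = #|K :\ u| by move: cK; rewrite (cardsD1 u) uK => -[].
    by rewrite -sum_nat_const; apply: eq_bigl => v; rewrite !inE andbC.
  have rr0 : 0 < r.+1 * r by rewrite muln_gt0.
  have split c d : \sum_(u in K) \sum_(v in K | v != u) (c * #|nbhd W [set u; v]| + d)
      = c * (\sum_(x in W) D x * (D x - 1)) + r.+1 * r * d.
    rewrite -sumcodeg -cnt big_distrr -big_split /=; apply: eq_bigr => u _.
    by rewrite big_split -big_distrr.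
  apply: (@leq_trans (r.+1 * r * (\sum_(x in W) D x * (D x - 1)) +
      r.+1 * r * (r * (r - 1) * #|W| + B' + 1))); first by nia.
  rewrite -split -(cnt B).
  apply: leq_sum => u uK; apply: leq_sum => v /andP[vK vu].
  have := noP (u, v); rewrite /= uK vK eq_sym vu /= => /negbT; rewrite -ltnNge.
  by lia.
have : 0 < r.+1 * r by rewrite muln_gt0.
by move: hi lo; rewrite /B -mulnDr ltn_mul2l; lia.
Qed.

(** Count ordered pairs inside (r+1)-cliques: each clique has (r+1) r of them, and each of the
    [degsum W] ordered edges lies in at most [J] cliques. *)
Lemma cliques_degsum W r J :
  {in W &, forall u v, e u v -> #|cliques W [set u; v] r.+1| <= J} ->
  r.+1 * r * #|cliques W set0 r.+1| <= degsum W * J.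
Proof.
move=> HJ; have := extension_count W set0 r.+1.
rewrite cards0 subn0 nbhd0 mulnAC => ->; rewrite mulnC big_distrr big_distrl /=.
apply: leq_sum => x xW; have := extension_count W [set x] r.+1.
rewrite cards1 subn1 setU0 /= => ->; rewrite /deg -sum_nat_const.
apply: leq_sum => y; rewrite nbhd1E => /andP[yW exy].
by apply: HJ => //; rewrite e_sym.
Qed.

(** [F] bounds from below the excess over the Turan density. Multiplying the ratios from
    [clique_growth] bounds k_{r+1} from below, and [cliques_degsum] bounds it from above; the factor
    [degsum W] cancels. *)
Lemma dense_js W r J F : 2 <= r -> 0 < #|W| -> 
  (r - 1) * #|W| ^ 2 + F <= r * degsum W ->
  {in W &, forall u v, e u v -> #|cliques W [set u; v] r.+1| <= J} ->
  #|W| ^ (r - 1) * F <= r ^ (r - 2) * (r - 1) * #|W| ^ 2 * J.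
Proof.
case: r => [//|[//|q]] _; rewrite !subSS !subn0.
set w := #|W| => w0; set r := q.+2; set E := degsum W => HE HJ.
have js := cliques_degsum HJ; rewrite -/E in js.
have Ele := degsum_le W; rewrite -/E -/w in Ele.
have E0 : 0 < E by rewrite lt0n; apply: contraTneq HE => ->; nia.
pose k s := #|cliques W set0 s|.
have growth s : (r * w ^ 2 + s.+1 * F) * k s.+1 <=
    r * w * s.+2 * k s.+2 + s.+1 * w ^ 2 * k s.+1.
  have := clique_growth W s; rewrite -/w -/E -/(k _) -/(k _).
  have tF : r * (w ^ 2 - E) + F <= w ^ 2.
    by rewrite mulnBr; move: HE Ele; rewrite /r; nia.
  move: (k s.+1) (k s.+2) (w ^ 2 - E) (w ^ 2) tF => a b t w2 tF CG.
  have := leq_mul (leqnn (s.+1 * a)) tF; have := leq_mul (leqnn r) CG.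
  by move: (r) => r'; clear; nia.
(* From edges up to r-cliques the main term of each ratio is enough, so [F] is dropped. *)
have chain s : s <= q ->
    \prod_(i < s) (q - i) * w ^ s * E <= r ^ s * (s.+2)`! * k s.+2.
  elim: s => [|s IHs] sq; first by rewrite big_ord0 !expn0 /E degsum_edges !mul1n.
  have {}IHs := IHs (ltnW sq).
  have gr : (q - s) * w * k s.+2 <= r * s.+3 * k s.+3.
    rewrite -(leq_pmul2l w0); have := growth s.+1; rewrite /r.
    have [d ->] : exists d, q = s + d by exists (q - s); lia.
    rewrite addKn; nia.
  rewrite big_ord_recr /= [(s.+3)`!]factS !expnS.
  apply: leq_trans (_ : (q - s) * w * (r ^ s * (s.+2)`! * k s.+2) <= _).
    apply: leq_trans (leq_mul (leqnn _) IHs).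
    by move: (\prod_(i < s) _) (w ^ s) (q - s) => P ws d; nia.
  have := leq_mul (leqnn (r ^ s * (s.+2)`!)) gr.
  by move: (r ^ s) (s.+2)`! (q - s) => P ws d; nia.
(* From r-cliques to (r+1)-cliques the main term vanishes and only [F] remains. *)
have last_step : F * k q.+2 <= w * q.+3 * k q.+3.
  have := growth q.+1; rewrite -/r; clear -r; have : 0 < r by [].
  by move: (r) => r'; nia.
have := chain q (leqnn q); rewrite -ffact_prod ffactnn => ch.
have q0 := fact_gt0 q.
rewrite -(leq_pmul2l (_ : 0 < q`! * E)) ?muln_gt0 ?q0 //.
apply: leq_trans (_ : w * F * (r ^ q * (q.+2)`! * k q.+2) <= _).
  by apply: leq_trans (leq_mul (leqnn _) ch); rewrite expnS; nia.
apply: leq_trans (_ : w * (r ^ q * (q.+2)`!) * (w * q.+3 * k q.+3) <= _).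
  by apply: leq_trans (leq_mul (leqnn _) last_step); nia.
apply: leq_trans (_ : w ^ 2 * r ^ q * (q.+1)`! * (E * J) <= _).
  apply: leq_trans (leq_mul (leqnn _) js).
  by rewrite [(q.+2)`!]factS -/(k _) -mulnn /r; nia.
by rewrite factS; nia.
Qed.

(** [clique_edge_codegree] picks an edge uv of [K] and [greedy] extends it by r - 1 vertices. The
    last choice has at least (r-1)^2 w / r^5 options; choice i before it has at least (r-2-i) w /
    r. *)
Lemma good_js W r K : 2 <= r -> r ^ 4 <= #|W| ->
  (forall v, v \in W -> r ^ 4 * (#|W| - deg W v) <= (r ^ 3 + 1) * #|W|) ->
  K \in cliques W set0 r.+1 ->
  exists u v, [/\ u \in W, v \in W, e u v &
    (r - 1) * #|W| ^ (r - 1) <= r ^ (r + 3) * #|cliques W [set u; v] r.+1|].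
Proof.
move=> r2 wr Hd /cliquesP[_ KW cK clK].
set w := #|W| in wr Hd *; set m := (r ^ 3 + 1) * w %/ r ^ 4.
have r4 : 0 < r ^ 4 by rewrite expn_gt0; lia.
have Hm v : v \in W -> w <= deg W v + m.
  by move=> vW; rewrite -leq_subLR /m leq_divRL // mulnC Hd.
have mle : r ^ 4 * m <= (r ^ 3 + 1) * w by rewrite mulnC leq_trunc_div.
(* Here w >= r^4 makes up for the rounding in [m]: w/r + w/r^4 is at least w/r + 1. *)
have wm : w <= r * m.
  have := ltn_ceil ((r ^ 3 + 1) * w) r4; rewrite -/m => lt.
  have r3 : 0 < r ^ 3 by rewrite expn_gt0; lia.
  rewrite -(leq_pmul2l r3); move: lt wr; rewrite (expnS r 3); move: (r ^ 3); nia.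
have [u [v [uK vK uv ha]]] := clique_edge_codegree Hm KW cK (ltnW r2).
exists u, v; have [uW vW] := (subsetP KW u uK, subsetP KW v vK).
split=> //; first exact: (cliqueP _ clK).
have := greedy Hm (r - 1) (K := [set u; v]) _ _ (leqnn _).
rewrite cards2 uv subUset !sub1set uW vW; move/(_ isT (cliqueS _ clK)).
rewrite subUset !sub1set uK vK; move/(_ isT).
set a := #|nbhd _ _| in ha *; rewrite -/w in ha.
have -> : 2 + (r - 1) = r.+1 by lia.
set C := #|cliques _ _ _|.
clearbody m a C w; clear K KW cK clK Hd Hm uK vK uW vW uv.
case: r r2 wr r4 mle wm ha => [//|[//|q]] _ _ _ mle wm ha.
rewrite !subSS !subn0 in ha *; set r := q.+2 in mle wm ha *.
have ab : r ^ 5 * (q * m) + q.+1 ^ 2 * w <= r ^ 5 * a.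
  rewrite -(leq_pmul2l (ltn0Sn r)).
  have := leq_mul (leqnn (2 * q.+1 * r.+1 + r * q * r.+1)) mle.
  have := leq_mul (leqnn (r ^ 4)) ha.
  (* Once [mle] and [ha] are combined, the slack is exactly (3r + 1) w. *)
  have := leq0n ((3 * r + 1) * w).
  by rewrite /r; clear; lia.
rewrite big_ord_recr /=; set P := \prod_(i < q) _; set b := a - q * m => hG.
have hb : q.+1 ^ 2 * w <= r ^ 5 * b by rewrite mulnBr leq_subRL // (leq_trans _ ab) ?leq_addr.
have hP : q`! * w ^ q <= r ^ q * P.
  rewrite -ffactnn ffact_prod -!iter_muln_1 -!big_const_ord -!big_split /=.
  apply: leq_prod => i _; have iq := ltn_ord i.
  have [d dE] : exists d, q = i + d by exists (q - i); lia.
  have r5 : 0 < r ^ 5 by rewrite expn_gt0.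
  have amd : i * m + d * m <= a.
    by rewrite -mulnDl -dE -(leq_pmul2l r5); apply: leq_trans ab; rewrite leq_addr.
  rewrite [X in X - i]dE addKn; apply: leq_trans (_ : d * (r * m) <= _).
    by rewrite leq_mul2l wm orbT.
  by rewrite mulnCA leq_mul2l leq_subRL ?amd ?orbT //; lia.
rewrite -(leq_pmul2l (_ : 0 < (q.+1)`!)) ?fact_gt0 //.
have -> : r + 3 = q + 5 by lia.
apply: leq_trans (_ : r ^ q * P * (r ^ 5 * b) <= _).
  by apply: leq_trans (leq_mul hP hb); rewrite factS expnS; nia.
apply: leq_trans (_ : r ^ q * r ^ 5 * ((q.+1)`! * C) <= _).
  by apply: leq_trans (leq_mul (leqnn _) hG); nia.
by rewrite expnD; nia.
Qed.

Lemma degE W x : deg W x = \sum_(y in W) e x y.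
Proof.
rewrite /deg -sum1_card [LHS]big_mkcond [RHS]big_mkcond /=.
by apply: eq_bigr => y _; rewrite nbhd1E; case: (y \in W); case: (e x y).
Qed.

Lemma degsum_del W v : v \in W -> degsum W = degsum (W :\ v) + 2 * deg W v.
Proof.
move=> vW; rewrite /degsum (big_setD1 v vW) /= mul2n -addnn addnCA; congr addn.
have -> : deg W v = \sum_(x in W :\ v) e x v.
  rewrite degE (big_setD1 v vW) /= e_irr add0n.
  by apply: eq_bigr => y _; rewrite e_sym.
rewrite -big_split /=; apply: eq_bigr => x _.
by rewrite !degE (big_setD1 v vW) /= addnC.
Qed.

End CliqueCounting.

(** * Sizes of the Turan graph and uniqueness in Turan's theorem *)

(** t_r(n) built vertex by vertex: vertex j has j - j/r neighbours among the smaller ones. *)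
Definition turan_size r n := \sum_(j < n) (j - j %/ r).

Definition class_size r n i := n %/ r + (i < n %% r).

Lemma class_sizeS r n i :
  i < r -> class_size r n.+1 i = class_size r n i + (n %% r == i).
Proof.
move=> ir; have r0 : 0 < r by lia.
have nr := ltn_pmod n r0.
have dvd : (r %| n.+1) = ((n %% r).+1 == r).
  rewrite {1}(divn_eq n r) -addnS /dvdn modnMDl.
  have [er|ne] := eqVneq (n %% r).+1 r; first by rewrite er modnn.
  by rewrite modn_small // ltn_neqAle ne nr.
rewrite /class_size divnS // modnS dvd; case: eqP => er; lia.
Qed.

Lemma card_residue r n i : i < r -> \sum_(j < n) (j %% r == i) = class_size r n i.
Proof.
move=> ir; elim: n => [|n IHn]; last by rewrite big_ord_recr /= IHn class_sizeS.
by rewrite big_ord0 /class_size div0n mod0n.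
Qed.

Section Turan.
Variables (T : finType) (e : rel T) (r : nat).
Hypotheses (e_irr : irreflexive e) (e_sym : symmetric e) (r0 : 0 < r).

(** The colours are labelled so that class i has the size of residue class i; an isomorphism with
    T_r then only has to match colours. *)
Definition turan_colouring (W : {set T}) (c : T -> nat) :=
  [/\ {in W, forall x, c x < r}, {in W &, forall x y, e x y = (c x != c y)} &
      forall i, i < r -> #|[set x in W | c x == i]| = class_size r #|W| i].

(* Induction by deleting a vertex of degree at most the minimum degree of T_r;
   if there is none, every clique on at most r vertices extends greedily. *)
Lemma turan_unique (W : {set T}) : cliques e W set0 r.+1 = set0 ->
  2 * turan_size r #|W| <= degsum e W ->
  degsum e W = 2 * turan_size r #|W| /\ exists c, turan_colouring W c.
Proof.
move cW: #|W| => m; elim: m W cW => [|m IHm] W cW noK hW.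
  have W0 : W = set0 by apply/eqP; rewrite -cards_eq0 cW.
  rewrite /degsum W0 big_set0 /turan_size big_ord0; split=> //.
  exists (fun=> 0); split=> [x|x y|i ir]; rewrite ?inE ?cards0 //.
  rewrite /class_size div0n mod0n; apply/eqP; rewrite cards_eq0.
  by apply/eqP/setP => x; rewrite !inE.
have [/existsP[v /andP[vW vdeg]]|] :=
    boolP [exists v, (v \in W) && (deg e W v <= m - m %/ r)]; last first.
  rewrite negb_exists => /forallP noV; exfalso.
  have Hm v : v \in W -> #|W| <= deg e W v + m %/ r.
    by move=> vW; have := noV v; rewrite vW /= -ltnNge cW; lia.
  have := greedy e_irr e_sym Hm r.+1 (sub0set W) (clique0 e) (leqnn _).
  rewrite cards0 noK cards0 muln0 leqNgt => /negP[]; apply: prodn_gt0 => i.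
  rewrite nbhd0 cW subn_gt0 ltnS; apply: leq_trans (leq_trunc_div m r).
  by rewrite mulnC leq_mul2l -ltnS ltn_ord orbT.
set W' := W :\ v.
have cW' : #|W'| = m by move: cW; rewrite (cardsD1 v) vW => -[].
have noK' : cliques e W' set0 r.+1 = set0.
  apply/setP => S; rewrite in_set0; apply/negP => /cliquesP[KS SW cS clS].
  have := in_set0 S; rewrite -noK => /negP[]; apply/cliquesP; split=> //.
  exact: subset_trans SW (subD1set _ _).
have delE := degsum_del e_irr e_sym vW; rewrite -/W' in delE.
have tS : turan_size r m.+1 = turan_size r m + (m - m %/ r).
  by rewrite /turan_size big_ord_recr.
have [|E' [c [cr ce cc]]] := IHm W' cW' noK'; first by lia.
rewrite cW' in cc.
have dv : deg e W v = m - m %/ r by lia.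
split; first by lia.
(* Some class has no neighbour of [v]: otherwise one neighbour from each class, together with [v],
   would form a K_{r+1}. *)
have [j [jr jN]] : exists j, j < r /\ {in W', forall x, c x = j -> ~~ e v x}.
  have [/existsP[j /forall_inP Hj]|] :=
      boolP [exists j : 'I_r, forall x in W', (c x == j) ==> ~~ e v x].
    by exists j; split=> // x xW cx; move: (Hj x xW); rewrite cx eqxx.
  rewrite negb_exists => /forallP noj; exfalso.
  have /fin_all_exists[g Hg] (j : 'I_r) : exists x, [/\ x \in W', c x = j & e v x].
    have := noj j; rewrite negb_forall_in => /exists_inP[x xW].
    by rewrite negb_imply negbK => /andP[/eqP cx evx]; exists x.
  have gI : injective g.
    by move=> i j gij; apply: val_inj; case: (Hg i) (Hg j) => _ /= <- _ [_ <- _]; rewrite gij.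
  have := in_set0 (v |: g @: setT); rewrite -noK => /negP[]; apply/cliquesP; split.
  - exact: sub0set.
  - rewrite subUset sub1set vW; apply/subsetP => _ /imsetP[i _ ->].
    by case: (Hg i) => /setD1P[].
  - rewrite cardsU1 card_imset // cardsT card_ord.
    suff -> : v \notin g @: setT by [].
    by apply/imsetP => -[i _ vg]; case: (Hg i) => _ _; rewrite -vg e_irr.
  apply/cliqueP => x y /setU1P[->|/imsetP[i _ ->]] /setU1P[->|/imsetP[k _ ->]].
  - by rewrite eqxx.
  - by case: (Hg k).
  - by rewrite e_sym; case: (Hg i).
  case: (Hg i) (Hg k) => iW ci _ [kW ck _] gik.
  by rewrite ce // ci ck; apply: contraNneq gik => /val_inj ->.
set V := [set x in W' | c x == j]; have cV : #|V| = class_size r m j by apply: cc.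
have NV : nbhd e W [set v] \subset W' :\: V.
  apply/subsetP => x; rewrite (nbhd1E e_sym) !inE => /andP[xW evx].
  rewrite xW andbT; have xv : x != v by apply: contraTneq evx => ->; rewrite e_irr.
  rewrite xv /= andbT; apply: contraTN evx => /eqP; apply: jN.
  by rewrite !inE xv.
have VW : V \subset W' by apply/subsetP => x; rewrite inE => /andP[].
have cD : #|W' :\: V| = m - #|V| by rewrite cardsD (setIidPr VW) cW'.
have Vle : #|V| <= m by rewrite -cW' subset_leq_card.
(* [v] has m - m/r neighbours, all outside [V], so #|V| <= m/r. No class is smaller, so equality
   holds and [v] is joined to all of [W'] outside [V]. *)
have := subset_leq_card NV; rewrite -/(deg e W v) dv cD => le1.
have Veq : #|V| = m %/ r by move: le1; rewrite cV /class_size in Vle *; lia.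
have /eqP NE : nbhd e W [set v] == W' :\: V by rewrite eqEcard NV -/(deg e W v) dv cD Veq leqnn.
have ev x : x \in W' -> e v x = (c x != j).
  move=> xW; have := nbhd1E e_sym W v x; rewrite NE in_setD xW andbT inE xW /= => ->.
  by case/setD1P: xW => _ ->.
set q := m %% r; have qr : q < r by apply: ltn_pmod.
(* [v] joins [V], but the class that grows from m to m + 1 carries the label q; so j and q, both of
   size m/r, swap labels. *)
pose s i := if i == j then q else if i == q then j else i.
have sr i : i < r -> s i < r by rewrite /s; case: (i == j) => //; case: (i == q).
have sK : involutive s.
  move=> i; rewrite /s; case: (eqVneq i j) => [->|ij].
    by case: (eqVneq q j) => [-> //|_]; rewrite eqxx.
  by case: (eqVneq i q) => [->|iq]; rewrite ?eqxx // (negPf ij) (negPf iq).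
have sI := inv_inj sK.
have sj : s j = q by rewrite /s eqxx.
have szs i : class_size r m (s i) = class_size r m i.
  have szq : class_size r m q = m %/ r by rewrite /class_size ltnn addn0.
  by rewrite /s; case: eqP => [->|_]; [|case: eqP => [->|]]; rewrite ?szq // -cV Veq.
exists (fun x => if x == v then q else s (c x)).
have W'E x : x \in W -> x != v -> x \in W' by move=> xW xv; rewrite !inE xv.
split=> [x xW|x y xW yW|i ir] /=.
- by case: (eqVneq x v) => // xv; apply/sr/cr/W'E.
- case: (eqVneq x v) (eqVneq y v) => [->|xv] [->|yv]; rewrite ?e_irr ?eqxx //.
  + by rewrite ev ?W'E // -sj eq_sym (inj_eq sI).
  + by rewrite e_sym ev ?W'E // -sj (inj_eq sI).
  by rewrite (inj_eq sI) ce ?W'E.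
rewrite cW class_sizeS // -(szs i) -cc ?sr // (cardsD1 v) inE vW eqxx /= addnC.
congr (_ + _).
apply: eq_card => x; rewrite !inE; case: eqVneq => //= xv.
by case: (x \in W) => //=; rewrite -(inj_eq sI) sK.
Qed.

End Turan.

(** * Edge counts and isomorphism for graphs on ['I_n] *)

Lemma double_num_edges n (e : rel 'I_n) :
  simple_graph e -> 2 * num_edges e = degsum e setT.
Proof.
move=> [e_irr e_sym].
have numE : num_edges e = \sum_(x < n) \sum_(y < n) ((x < y) && e x y).
  rewrite /num_edges -sum1_card pair_big /= [LHS]big_mkcond /=.
  by apply: eq_bigr => p _; rewrite inE; case: (_ && _).
rewrite mul2n -addnn {1}numE numE [X in _ + X]exchange_big -big_split /=.
apply: eq_big => x; rewrite ?inE // => _.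
rewrite (degE e_sym) -big_split /=; apply: eq_big => y; rewrite ?inE // => _.
by rewrite (e_sym y x); case: ltngtP => [|lt|/ord_inj ->]; rewrite ?e_irr ?addn0 //.
Qed.

(** Group the edges by their larger end j: exactly j/r of the smaller vertices share its residue. *)
Lemma turan_numberE r n : 0 < r -> turan_number r n = turan_size r n.
Proof.
move=> r0; rewrite /turan_number /num_edges -sum1_card.
transitivity (\sum_(j < n) \sum_(i < n | i < j) (i %% r != j %% r)).
  rewrite (exchange_big_dep predT) //= pair_big_dep /= [LHS]big_mkcond [RHS]big_mkcond /=.
  by apply: eq_bigr => p _; rewrite inE /turan_rel; case: (_ < _); case: (_ != _).
apply: eq_bigr => j _.
rewrite -(big_ord_widen n (fun i => nat_of_bool (i %% r != j %% r))) 1?ltnW //.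
have := card_residue j (ltn_pmod j r0); rewrite /class_size ltnn addn0 => <-.
rewrite -[X in X - _]card_ord -sum1_card.
rewrite (_ : \sum_(i in 'I_j) 1 = \sum_(i < j) (i %% r != j %% r) +
             \sum_(i < j) (i %% r == j %% r)) ?addnK //.
by rewrite -big_split /=; apply: eq_bigr => i _; case: eqP.
Qed.

(** Colours and residues occur with equal multiplicities, so one list is a permutation of the other;
    this permutation is the isomorphism. *)
Lemma turan_colouring_iso n (e : rel 'I_n) r c :
  turan_colouring e r setT c -> graph_iso e (@turan_rel r n).
Proof.
case=> cr ce cc; rewrite cardsT card_ord in cc.
have /tuple_permP[p cp] : perm_eq [tuple c x | x < n] [tuple x %% r | x < n].
  apply/allP => a; rewrite mem_cat => aI.
  have ar : a < r.
    case/orP: aI => /mapP[x _ ->]; first exact: cr.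
    by rewrite ltn_pmod //; apply: leq_ltn_trans (cr x (in_setT x)).
  rewrite /= !count_map -!sum1_count; apply/eqP.
  rewrite -enumT !big_enum_cond /=.
  transitivity (class_size r n a).
    by rewrite -cc // -sum1_card; apply: eq_bigl => x; rewrite !inE.
  by rewrite -card_residue // [RHS]big_mkcond /= big_mkcond; apply: eq_bigr => i _; case: eqP.
have cE x : c x = p x %% r.
  have := congr1 (fun s => nth 0 s x) cp.
  by rewrite -!tnth_nth !tnth_mktuple.
exists p; split; first by exists (p^-1)%g; [exact: permK|exact: permKV].
by move=> x y; rewrite ce ?inE // !cE.
Qed.

(** * Numerical estimates for the deletion process *)

Lemma turan_size_ge r n : (r - 1) * n ^ 2 <= 2 * r * turan_size r n + (r - 1) * n.
Proof.
elim: n => [|n IHn]; first by rewrite muln0.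
rewrite /turan_size big_ord_recr /= -/(turan_size r n).
have : (r - 1) * n <= r * (n - n %/ r).
  by rewrite mulnBl mul1n mulnBr leq_sub2l // mulnC leq_trunc_div.
by move: (n - _) (turan_size r n) IHn => x t; nia.
Qed.

Lemma bernoulli_nat r j : r ^ j * (r - j) <= (r - 1) ^ j * r.
Proof.
elim: j => [|j IHj]; first by rewrite subn0.
case: r IHj => [|r] IHj; first by rewrite exp0n.
have := leq_mul (leqnn r) IHj; rewrite !subSS !subn0 !expnS.
move: (r.+1 ^ j) (r ^ j) => a b le.
have [jr|/ltnW rj] := leqP j r; last by rewrite (eqP rj) muln0.
have [d dE] : exists d, r = j + d by exists (r - j); lia.
move: le; rewrite subSn // dE addKn -!mulnA => le; nia.
Qed.

(** Bernoulli gives (1 - 1/r)^(r-1) >= 1/r, so shrinking n to w costs at most a factor r. *)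
Lemma expn_pred_le r n w : 1 < r -> (r - 1) * n <= r * w -> n ^ (r - 1) <= r * w ^ (r - 1).
Proof.
move=> r1 nw; have r1' := ltnW r1.
have := bernoulli_nat r (r - 1); rewrite subKn // muln1 => ber.
have pos : 0 < r ^ (r - 1) by rewrite expn_gt0 r1'.
have : ((r - 1) * n) ^ (r - 1) <= (r * w) ^ (r - 1) by rewrite leq_exp2r ?subn_gt0.
rewrite !expnMn => le; rewrite -(leq_pmul2l pos).
have {}ber := leq_mul ber (leqnn (n ^ (r - 1))); apply: leq_trans ber _.
have {}le := leq_mul (leqnn r) le; move: le.
by move: (_ ^ _) (r ^ _) (n ^ _) (w ^ _) => a b c d; nia.
Qed.

(** The total gain of n/r deletions covers the initial deficit r^3 (r-1) n and leaves n^2 / r^2. *)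
Lemma deletion_gain r n : 2 <= r -> r ^ 8 < n ->
  n ^ 2 + r ^ 5 * (r - 1) * n <= r ^ 2 * (n %/ r * (n - r ^ 4)).
Proof.
move=> r2 nr.
have r0 : 0 < r by lia.
have lr : n <= r * (n %/ r) + r by rewrite mulnC {1}(divn_eq n r) leq_add2l ltnW ?ltn_pmod.
have r6 : r ^ 6 + r ^ 5 + r ^ 2 <= n.
  have r65 : r ^ 5 <= r ^ 6 by rewrite leq_pexp2l.
  have r62 : r ^ 2 <= r ^ 6 by rewrite leq_pexp2l.
  have r22 : 2 ^ 2 <= r ^ 2 by rewrite leq_exp2r.
  have := leq_mul r22 (leqnn (r ^ 6)); rewrite -expnD; lia.
have r4n : r ^ 4 <= n.
  by apply: leq_trans (ltnW nr); rewrite leq_pexp2l.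
have rn : r <= n by apply: leq_trans r4n; rewrite -{1}(expn1 r) leq_pexp2l.
apply: leq_trans (_ : r * ((n - r) * (n - r ^ 4)) <= _); last first.
  by rewrite -mulnn -[r * r * _]mulnA leq_mul2l mulnA leq_mul2r; lia.
have r_expand : r * n ^ 2 <= r * ((n - r) * (n - r ^ 4)) + (r ^ 2 + r ^ 5) * n.
  rewrite (expnS r 4); move: (r ^ 4) r4n => R Rn.
  have [a aE] : exists a, n = r + a by exists (n - r); lia.
  have [b bE] : exists b, n = R + b by exists (n - R); lia.
  have -> : n - r = a by lia.
  have -> : n - R = b by lia.
  have : n * n <= a * b + (r + R) * n.
    have -> : n * n = r * n + a * n by rewrite -mulnDl -aE.
    have -> : a * n = a * R + a * b by rewrite -mulnDr -bE.
    have : a * R <= n * R by rewrite leq_mul2r aE leq_addl orbT.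
    clear; lia.
  move/(leq_mul (leqnn r)); rewrite -!mulnn; clear; lia.
have n2 : n ^ 2 + (r ^ 6 + r ^ 5 + r ^ 2) * n <= r * n ^ 2.
  rewrite -mulnn; apply: leq_trans (leq_mul r2 (leqnn _)).
  by rewrite mul2n -addnn leq_add2l leq_mul2r r6 orbT.
have : r ^ 5 * (r - 1) * n <= r ^ 6 * n.
  by rewrite leq_mul2r [r ^ 6]expnSr leq_mul2l leq_subr !orbT.
by rewrite !mulnDl in n2 r_expand; lia.
Qed.

(* Deleting a vertex of low degree d raises 2 r e - (r - 1) w^2, scaled by r^3,
   by at least n - r^4. *)
Lemma deletion_step r n l w d : 0 < r -> r ^ 4 <= w.+1 -> n <= 2 * w.+1 ->
  2 * r ^ 4 <= n -> (r ^ 3 + 1) * w.+1 < r ^ 4 * (w.+1 - d) ->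
  d < w - w %/ r /\
  forall E, r ^ 3 * (r - 1) * w.+1 ^ 2 + l * (n - r ^ 4) <=
              r ^ 3 * (r * (E + 2 * d) + (r - 1) * n) ->
            r ^ 3 * (r - 1) * w ^ 2 + l.+1 * (n - r ^ 4) <=
              r ^ 3 * (r * E + (r - 1) * n).
Proof.
move=> r0 r4w nw r4n; rewrite mulnBr ltn_subRL => vbad.
have wr : (r - 1) * w <= r * (w - w %/ r).
  by rewrite mulnBl mul1n mulnBr leq_sub2l // mulnC leq_trunc_div.
have R0 : 0 < r ^ 3 by rewrite expn_gt0 r0.
move: r4w r4n vbad; rewrite (expnS r 3); move: (r ^ 3) R0 => R R0 r4w r4n vbad.
split=> [|E].
  (* w - w/r is t_r(w+1) - t_r(w), so this makes e - t_r rise strictly; w + 1 >= r^4 absorbs the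
     lower-order term r^3 (r-1). *)
  rewrite -(ltn_pmul2l r0); apply: leq_trans wr; rewrite -(ltn_pmul2l R0).
  by case: r r0 r4w vbad {nw r4n} => // p _; rewrite subn1 /=; clear; lia.
have [x xE] : exists x, n = r * R + x.
  by exists (n - r * R); rewrite subnKC // (leq_trans _ r4n) // leq_pmull.
have xn : n - r * R = x by rewrite xE addKn.
rewrite xn; rewrite xE in nw *.
(* The gain is at least 2 (w+1) - r^3 (r-1), and 2 (w+1) >= n. *)
case: r r0 vbad nw {wr r4w r4n xE xn} => // p _; rewrite subn1 /= -!mulnn; lia.
Qed.

(** * The deletion process and the final contradiction *)

(* js > n^(r-1) / r^(r+5)  is stated, clearing denominators, as
   n^(r-1) < js * r^(r+5) over nat. *)
Theorem theorem7 (r n : nat) (e : rel 'I_n) :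
  2 <= r -> r ^ 8 < n ->
  simple_graph e ->
  turan_number r n <= num_edges e ->
  ~ graph_iso e (@turan_rel r n) ->
  n ^ (r - 1) < js2 e r * r ^ (r + 5).
Proof.
move=> r2 nr simp eT nIso; rewrite ltnNge; apply/negP => small.
have [e_irr e_sym] := simp; have r0 : 0 < r by lia.
have n0 : 0 < n by lia.
have N0 : 0 < n ^ (r - 1) by rewrite expn_gt0 n0.
set J := js2 e r in small.
have HJ (W : {set 'I_n}) u v : e u v -> #|cliques e W [set u; v] r.+1| <= J.
  move=> euv; apply: leq_trans (_ : cliques_through e r.+1 u v <= _).
    apply: subset_leq_card; apply/subsetP => S /cliquesP[KS _ cS clS].
    by rewrite inE cS eqxx; move: KS; rewrite subUset !sub1set => /andP[-> ->].
  exact: (leq_bigmax_cond (u, v) euv).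
have r4n : 2 * r ^ 4 <= n.
  apply: leq_trans (ltnW nr); rewrite (expnD r 4 4) leq_mul2r; apply/orP; right.
  by apply: leq_trans r2 _; rewrite -{1}(expn1 r) leq_pexp2l.
have size_bounds l : l <= n %/ r ->
    [/\ n <= 2 * (n - l), r ^ 4 <= n - l & n ^ (r - 1) <= r * (n - l) ^ (r - 1)].
  rewrite leq_divRL // => lr.
  have nw : n <= 2 * (n - l) by nia.
  split=> //; first by lia.
  by apply: expn_pred_le => //; rewrite mulnBr mulnBl mul1n leq_sub2l // mulnC.
(* The term [(0 < l)] records that the excess over t_r is strict after the first deletion; the last
   inequality accumulates the gains of [deletion_step]. *)
have deletion l : l <= n %/ r -> exists W : {set 'I_n}, [/\ #|W| = n - l,
    2 * turan_size r (n - l) + (0 < l) <= degsum e W &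
    r ^ 3 * (r - 1) * (n - l) ^ 2 + l * (n - r ^ 4) <=
      r ^ 3 * (r * degsum e W + (r - 1) * n)].
  elim: l => [_|l IHl ln].
    have dT : 2 * turan_size r n <= degsum e setT.
      by rewrite -double_num_edges // -turan_numberE // leq_mul2l eT orbT.
    exists setT; rewrite subn0 cardsT card_ord addn0 addn0; split=> //.
    rewrite -mulnA leq_mul2l; apply/orP; right.
    apply: leq_trans (turan_size_ge r n) _.
    by rewrite leq_add2r [2 * r]mulnC -mulnA leq_mul2l dT orbT.
  have [W [cW hT hP]] := IHl (ltnW ln).
  have [nw r4w powle] := size_bounds l (ltnW ln).
  have [/existsP[v /andP[vW vbad]]|] :=
      boolP [exists v, (v \in W) && ((r ^ 3 + 1) * #|W| < r ^ 4 * (#|W| - deg e W v))].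
    exists (W :\ v); have dE := degsum_del e_irr e_sym vW.
    have [w wE] : exists w, n - l = w.+1.
      exists (n - l).-1; rewrite prednK //.
      by apply: leq_trans r4w; rewrite expn_gt0 r0.
    have wE' : n - l.+1 = w by rewrite subnS wE.
    have tS : turan_size r w.+1 = turan_size r w + (w - w %/ r).
      by rewrite /turan_size big_ord_recr.
    rewrite cW wE in vbad; rewrite wE tS in hT; rewrite wE in hP nw r4w.
    have [lt next] := deletion_step l r0 r4w nw r4n vbad.
    rewrite wE'; split.
    - by move: cW; rewrite (cardsD1 v) vW wE => -[].
    - move: hT lt; rewrite dE /=.
      move: (w - _) (turan_size _ _) (degsum _ _) (deg _ _ _) => s t E d.
      by clear; lia.
    by apply: next; rewrite -dE.
  rewrite negb_exists => /forallP good.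
  (* A K_{r+1} here would give r (r-1) n^(r-1) <= r^(r+5) J, against [small] because r (r-1) >=
     2. *)
  have noK : cliques e W set0 r.+1 = set0.
    apply/eqP; rewrite -subset0; apply/subsetP => K HK; exfalso.
    have [|v vW|u [v [uW vW euv]]] := good_js e_irr e_sym r2 _ _ HK.
    - by rewrite cW.
    - by have := good v; rewrite vW -leqNgt.
    have := HJ W u v euv; set C := #|_| => CJ; rewrite cW => le.
    have {}le := leq_trans le (leq_mul (leqnn _) CJ).
    have := leq_mul (leqnn (r * (r - 1))) powle; have := leq_mul (leqnn (r ^ 2)) le.
    move: small N0; rewrite (_ : r + 5 = r + 3 + 2) ?[r ^ (_ + 2)]expnD -?addnA //.
    move: (r ^ (r + 3)) (n ^ (r - 1)) ((n - l) ^ (r - 1)) => Q N M; rewrite -mulnn.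
    by case: (r) r2 => [|[|p]] // _; rewrite subn1 /=; clear; nia.
  have [|dE [c col]] := turan_unique e_irr e_sym r0 noK.
    by rewrite cW (leq_trans (leq_addr _ _) hT).
  (* Equality in Turan's theorem excludes a strict excess, so nothing was deleted and the whole
     graph is T_r(n). *)
  have l0 : l = 0 by move: hT; rewrite dE cW -[X in _ <= X]addn0 leq_add2l; case: (l).
  case: nIso; apply: turan_colouring_iso.
  suff <- : W = setT by exact: col.
  by apply/eqP; rewrite eqEcard subsetT cardsT card_ord cW l0 subn0 leqnn.
have [W [cW _ hP]] := deletion _ (leqnn _).
have [nw r4w powle] := size_bounds _ (leqnn (n %/ r)).
move: cW hP; set w := n - _ in nw r4w powle * => cW hP.
have gain := deletion_gain r2 nr.
pose F := r * degsum e W - (r - 1) * w ^ 2.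
(* Multiply the invariant at l = n/r by r^2 and cancel the deficit with [deletion_gain]. *)
have hF : n ^ 2 <= r ^ 5 * F.
  rewrite -[_ * (r - 1) * _]mulnA in hP; move: gain (leq_mul (leqnn (r ^ 2)) hP).
  have -> : r ^ 5 = r ^ 2 * r ^ 3 by rewrite -expnD.
  rewrite /F.
  move: (r * degsum e W) ((r - 1) * w ^ 2) (n %/ r * _) (r ^ 2) (r ^ 3).
  move: (n ^ 2) (r - 1) => n2 p E w2 x R2 R3 g h.
  by rewrite mulnBr; move: g h; clear; lia.
have F0 : 0 < F.
  by rewrite lt0n; apply: contraTneq hF => ->; rewrite muln0 -ltnNge expn_gt0 n0.
have w0 : 0 < w by apply: leq_trans r4w; rewrite expn_gt0 r0.
have : w ^ (r - 1) * F <= r ^ (r - 2) * (r - 1) * w ^ 2 * J.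
  rewrite -cW; apply: (dense_js e_irr e_sym) => // [||u v _ _]; rewrite ?cW //.
    by rewrite subnKC // ltnW // -subn_gt0.
  exact: HJ.
have wn2 : w ^ 2 <= n ^ 2 by rewrite leq_exp2r // leq_subr.
have n20 : 0 < n ^ 2 by rewrite expn_gt0 n0.
have r7 : r ^ (r + 5) = r ^ 5 * r ^ 2 * r ^ (r - 2).
  by rewrite -!expnD; congr (_ ^ _); clear -r2; lia.
move: small powle hF; rewrite r7; move: (r ^ (r - 2)) (r ^ 5) => Q R5.
move: (n ^ (r - 1)) (w ^ (r - 1)) (n ^ 2) (w ^ 2) wn2 n20 N0 => N M n2 w2 wn2 n20 N0.
move=> small powle hF le.
have step1 : N * n2 <= r * R5 * (Q * (r - 1) * w2 * J).
  apply: leq_trans (leq_mul powle hF) _.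
  by rewrite mulnACA leq_mul2l le orbT.
(* With w <= n and [small], the bound of [dense_js] becomes r <= r - 1 after cancelling n^(r-1)
   n^2. *)
have step2 : r * (N * n2) <= (r - 1) * n2 * N.
  apply: leq_trans (leq_mul (leqnn r) step1) _.
  apply: leq_trans (leq_mul (leq_mul (leqnn (r - 1)) wn2) small).
  by rewrite -mulnn; clear; lia.
move: step2; rewrite -mulnA [n2 * N]mulnC leq_pmul2r ?muln_gt0 ?N0 //.
by rewrite leq_subRL // add1n ltnn.
Qed.
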